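(* Let $\chi$ be the character of a finite-dimensional representation of a finite group $G$ over a field $F$ of characteristic $0$. Let $g\in G$ be an element of order $m=p_1^{a_1}\cdots p_r^{a_r}$ (with $p_1<p_2<\cdots$ primes, $a_i>0$) such that $\chi(g)\in\mathbb{Z}$, and let $t=\chi(1)+|\chi(g)|$. If $\chi(g)\le0$, then $t\in\mathbb{N}p_1+\cdots+\mathbb{N}p_r$. If $\chi(g)>0$ and $t$ is odd, then $m$ has an odd prime divisor and $t\ge\ell$, where $\ell$ is the smallest odd prime dividing $m$.
   Context: $\mathbb{N}=\{0,1,2,\dots\}$; $\mathbb{N}p_1+\cdots+\mathbb{N}p_r$ is the set of non-negative integer linear combinations of $p_1,\dots,p_r$. Since $F$ has characteristic $0$, $\mathbb{Z}\subseteq F$, and $\chi(g)\in\mathbb{Z}$ means $\chi(g)$ lies in this copy of $\mathbb{Z}$. *)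

(* Defs.v *)
From HB Require Import structures.
From mathcomp Require Import all_boot all_order all_algebra all_fingroup.
From mathcomp Require Import all_solvable all_field all_character.

Set Implicit Arguments.
Unset Strict Implicit.
Unset Printing Implicit Defensive.

Import Order.TTheory GRing.Theory Num.Theory.
Local Open Scope ring_scope.

(* MathComp's [cfRepr] is the character only for representations over [algC];
   this is the character over an arbitrary field, with values in that field. *)
Definition repr_char (F : fieldType) (gT : finGroupType) (G : {group gT})
  (n : nat) (rG : mx_representation F G n) (x : gT) : F := \tr (rG x).

(* t is in N p_1 + ... + N p_r for s = [:: p_1; ...; p_r]; the coefficient
   of p is [c p], which loses no generality since coefficients of equal
   generators can be added together. *)
Definition in_nat_span (s : seq nat) (t : nat) : Prop :=
  exists c : nat -> nat, t = (\sum_(p <- s) c p * p)%N.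

Definition smallest_odd_prime_divisor (m l : nat) : Prop :=
  [/\ prime l, odd l, l %| m
    & forall q : nat, prime q -> odd q -> q %| m -> l <= q]%N.

(* Main.v *)
(* The eigenvalues of g are m-th roots of unity, and adding |chi(g)| copies of 1
   or of -1 turns chi(g) = z into a vanishing sum of t roots of unity, of order
   dividing m or 2m.  Integer relations between roots of unity do not depend on
   the field of characteristic 0, so the theorem of Lam and Leung on the lengths
   of such sums can be proved over algC and applied here.

   For Lam-Leung, let p be a prime factor of m = n p and write a vanishing sum
   of m-th roots of unity as sum_i x_i zeta^i, i < p, where x_i is a sum of n-th
   roots of unity.  If p | n, take zeta of order m: Galois conjugation shows that
   every x_i vanishes, which reduces to squarefree m.  If m is squarefree, let p
   be its largest prime factor and zeta of order p: the x_i have a common value.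
   If a shortest x_i is empty, every x_i vanishes.  Otherwise, p_1 < p_2 being the
   smallest prime factors, either the terms of the shortest x_i occur in all the
   others, which exhibits a coset of the p-th roots of unity that can be removed,
   or the sum has length at least (p_1 - 1)(p_2 - 1), hence in N p_1 + N p_2. *)
Require Import Defs.
From HB Require Import structures.
From mathcomp Require Import all_boot all_order all_algebra all_fingroup.
From mathcomp Require Import all_solvable all_field all_character.
From mathcomp Require Import zify.

Set Implicit Arguments.
Unset Strict Implicit.
Unset Printing Implicit Defensive.

Import Order.TTheory GRing.Theory Num.Theory.
Local Open Scope ring_scope.

(** * Slicing lists of roots of unity along cosets *)

(* Lists of n-th roots of unity, up to order, are the elements of N[mu_n]. *)
Definition unity_seq (n : nat) (s : seq algC) : bool :=
  all (fun u => u ^+ n == 1) s.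

(** These are the terms of [s] in the coset a mu_n, divided by [a]. For a = zeta^i this is the x_i
    of the overview. *)
Definition slice (n : nat) (a : algC) (s : seq algC) : seq algC :=
  [seq v <- [seq u / a | u <- s] | v ^+ n == 1].

Lemma slice_unity n a s : unity_seq n (slice n a s).
Proof. exact: filter_all. Qed.

Lemma mem_slice n a s v : a != 0 ->
  (v \in slice n a s) = (v ^+ n == 1) && (v * a \in s).
Proof.
move=> a0; rewrite mem_filter; congr (_ && _).
apply/mapP/idP => [[u us ->]|vs]; first by rewrite divfK.
by exists (v * a); rewrite ?mulfK.
Qed.

Lemma prim_root_expr_inj (R : nzRingType) (z : R) p : p.-primitive_root z ->
  {in gtn p &, injective (fun i => z ^+ i)}.
Proof.
move=> pz i j; rewrite !inE => ip jp /eqP.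
by rewrite (eq_prim_root_expr pz) !modn_small // => /eqP.
Qed.

Section Slices.

Variables (n p : nat) (zeta : algC).
(** For n > 0 the powers zeta^i, i < p, then represent the cosets of mu_n in mu_(n p). This covers
    both zeta of order n p and, when p is prime to n, zeta of order p. *)
Hypothesis (zeta_prim : p.-primitive_root (zeta ^+ n)).

Lemma slice_base_neq0 i : (0 < n)%N -> zeta ^+ i != 0.
Proof.
move=> n0; apply/expf_neq0/eqP => z0; have := prim_expr_order zeta_prim.
rewrite z0 expr0n gtn_eqF // expr0n gtn_eqF ?(prim_order_gt0 zeta_prim) //.
by move/eqP; rewrite eq_sym oner_eq0.
Qed.

(** The power u^n is a p-th root of unity, hence (zeta^n)^i for a single i < p, and this i names the
    coset of u. *)
Lemma slice_index (u : algC) : (0 < n)%N -> u ^+ (n * p) = 1 ->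
  exists2 i : 'I_p, (u / zeta ^+ i) ^+ n = 1
    & forall j : 'I_p, ((u / zeta ^+ j) ^+ n == 1) = (j == i).
Proof.
move=> n0; rewrite exprM => /(prim_rootP zeta_prim) [i ui].
have E (j : 'I_p) : ((u / zeta ^+ j) ^+ n == 1) = (j == i).
  have z0 : (zeta ^+ n) ^+ j != 0 by rewrite -exprM slice_base_neq0.
  rewrite expr_div_n ui [zeta ^+ j ^+ n]exprAC -(inj_eq (mulIf z0)) /= divfK // mul1r.
  by rewrite (eq_prim_root_expr zeta_prim) !modn_small // eq_sym.
by exists i => //; apply/eqP; rewrite E.
Qed.

Lemma big_slice (V : nmodType) (f : algC -> V) s :
  (0 < n)%N -> unity_seq (n * p) s ->
  \sum_(u <- s) f u =
    \sum_(i < p) \sum_(v <- slice n (zeta ^+ i) s) f (v * zeta ^+ i).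
Proof.
move=> n0 /allP us.
under [RHS]eq_bigr do rewrite big_filter big_map.
rewrite (exchange_big_dep xpredT) //= big_seq [RHS]big_seq.
apply: eq_bigr => u /us /eqP /(slice_index n0) [i _ E].
rewrite (big_pred1 i) => [|j]; last by rewrite E.
by rewrite divfK // slice_base_neq0.
Qed.

Lemma sum_slice s : (0 < n)%N -> unity_seq (n * p) s ->
  \sum_(u <- s) u =
    \sum_(i < p) (\sum_(v <- slice n (zeta ^+ i) s) v) * zeta ^+ i.
Proof.
move=> n0 us; rewrite (big_slice id) //.
by apply: eq_bigr => i _; rewrite mulr_suml.
Qed.

Lemma size_slice s : (0 < n)%N -> unity_seq (n * p) s ->
  size s = (\sum_(i < p) size (slice n (zeta ^+ i) s))%N.
Proof.
move=> n0 us; rewrite -sum1_size (big_slice (fun=> 1%N)) //.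
by apply: eq_bigr => i _; rewrite sum1_size.
Qed.

Lemma slice_subset s s' : (0 < n)%N -> unity_seq (n * p) s ->
  (forall i : 'I_p, {subset slice n (zeta ^+ i) s <= slice n (zeta ^+ i) s'}) ->
  {subset s <= s'}.
Proof.
move=> n0 /allP us sub u u_s.
have /eqP /(slice_index n0) [i ui _] := us u u_s.
have /sub : u / zeta ^+ i \in slice n (zeta ^+ i) s.
  by rewrite mem_slice ?slice_base_neq0 // ui eqxx divfK // slice_base_neq0.
rewrite mem_slice ?slice_base_neq0 // => /andP[_].
by rewrite divfK // slice_base_neq0.
Qed.

End Slices.

(** * Linear relations over cyclotomic fields *)

Lemma exp_prim_root_coprime (R : nzRingType) p n (zeta : R) :
  coprime p n -> p.-primitive_root zeta -> p.-primitive_root (zeta ^+ n).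
Proof.
move=> co_pn pz; have := exp_prim_root pz n.
by rewrite gcdnC (eqnP co_pn) divn1.
Qed.

(* By Galois theory this says that [a] lies in the n-th cyclotomic field. *)
Definition cyclo_fixed (n : nat) (a : algC) : Prop :=
  forall nu : {rmorphism algC -> algC},
    (forall v, v ^+ n = 1 -> nu v = v) -> nu a = a.

Lemma cyclo_fixed_sum n s : unity_seq n s -> cyclo_fixed n (\sum_(u <- s) u).
Proof.
move=> /allP us nu nuK; rewrite rmorph_sum big_seq [RHS]big_seq.
by apply: eq_bigr => u /us /eqP /nuK.
Qed.

Lemma cyclo_fixedB n a b :
  cyclo_fixed n a -> cyclo_fixed n b -> cyclo_fixed n (a - b).
Proof. by move=> fa fb nu nuK; rewrite rmorphB fa ?fb. Qed.

(** Apply the automorphism that raises m-th roots of unity to the power k; as k = 1 mod n, it fixes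
    mu_n and therefore the coefficients. *)
Lemma cyclo_conj m n k (a : nat -> algC) zeta p :
  coprime k m -> (n %| m)%N -> k = 1 %[mod n] -> zeta ^+ m = 1 ->
  (forall i, (i < p)%N -> cyclo_fixed n (a i)) ->
  \sum_(i < p) a i * zeta ^+ i = 0 ->
  \sum_(i < p) a i * (zeta ^+ k) ^+ i = 0.
Proof.
move=> co_km n_m k1 zm fa /(congr1 (sval (Qn_aut_exists co_km))).
case: (Qn_aut_exists _) => nu /= nuE; rewrite rmorph0 rmorph_sum => s0; rewrite -[RHS]s0.
apply: eq_bigr => i _; rewrite rmorphM rmorphXn /= (nuE zeta) // (fa i) // => v vn.
rewrite nuE; last by case/dvdnP: n_m => c ->; rewrite mulnC exprM vn expr1n.
by rewrite -(expr_mod k vn) k1 expr_mod.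
Qed.

Lemma poly_coefs_eq0 (R : idomainType) p (a : nat -> R) rs :
  uniq rs -> (p <= size rs)%N ->
  (forall r, r \in rs -> \sum_(i < p) a i * r ^+ i = 0) ->
  forall i, (i < p)%N -> a i = 0.
Proof.
move=> rs_uniq p_rs rs0 i ip.
have [P0|P0] := eqVneq (\poly_(i < p) a i) 0.
  by have := congr1 (fun q : {poly R} => q`_i) P0; rewrite coef_poly ip coef0.
have /(max_poly_roots P0) : all (root (\poly_(i < p) a i)) rs.
  by apply/allP => r /rs0 r0; rewrite rootE horner_poly r0.
move=> /(_ rs_uniq) /leq_trans /(_ (size_poly _ _)).
by rewrite ltnNge p_rs.
Qed.

(** As p is prime to n, zeta has degree p - 1 over the n-th cyclotomic field, so 1 + zeta + ... +
    zeta^(p-1) = 0 is the only relation up to a scalar. *)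
Lemma cyclo_coefs_eq p n zeta (a : nat -> algC) :
  (0 < n)%N -> prime p -> coprime p n -> p.-primitive_root zeta ->
  (forall i, (i < p)%N -> cyclo_fixed n (a i)) ->
  \sum_(i < p) a i * zeta ^+ i = 0 ->
  forall i j, (i < p)%N -> (j < p)%N -> a i = a j.
Proof.
move=> n0 pp co_pn pz fa s0.
have p1 := prime_gt1 pp.
(* The polynomial [a_0 + ... + a_{p-1} X^{p-1}] minus [a_{p-1}] times
   [1 + ... + X^{p-1}] has degree < p - 1 and vanishes at [zeta^k], 0 < k < p. *)
suff E i : (i < p)%N -> a i = a p.-1 by move=> i j ip jp; rewrite !E.
have E0 : forall j, (j < p.-1)%N -> a j - a p.-1 = 0.
  apply: (@poly_coefs_eq0 _ _ _ [seq zeta ^+ k | k <- iota 1 p.-1]).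
  - rewrite map_inj_in_uniq ?iota_uniq // => j1 j2.
    rewrite !mem_iota !add1n !(prednK (prime_gt0 pp)) => /andP[_ j1p] /andP[_ j2p].
    exact: (prim_root_expr_inj pz).
  - by rewrite size_map size_iota.
  move=> _ /mapP [k + ->]; rewrite mem_iota add1n (prednK (prime_gt0 pp)) => /andP[k0 kp].
  (* The exponent [K] acts on zeta as k does, and trivially on mu_n. *)
  pose K := chinese p n k 1.
  have Kp : K = k %[mod p] by rewrite chinese_modl.
  have Kn : K = 1 %[mod n] by rewrite chinese_modr.
  have co_K : coprime K (p * n).
    rewrite coprimeMr -(coprime_modl _ p) Kp coprime_modl -(coprime_modl _ n) Kn.
    by rewrite coprime_modl coprime1n andbT coprime_sym prime_coprime // gtnNdvd.
  have zpn : zeta ^+ (p * n) = 1 by rewrite exprM (prim_expr_order pz) expr1n.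
  have := cyclo_conj co_K (dvdn_mull p (dvdnn n)) Kn zpn fa s0.
  have -> : zeta ^+ K = zeta ^+ k by apply/eqP; rewrite (eq_prim_root_expr pz) Kp.
  move=> sk.
  have geo : \sum_(i < p) zeta ^+ k ^+ i = 0.
    have zk1 : zeta ^+ k - 1 != 0.
      rewrite subr_eq0 -(expr0 zeta) (eq_prim_root_expr pz) mod0n modn_small //.
      by rewrite -lt0n.
    apply: (mulfI zk1); rewrite mulr0 -subrX1 -exprM mulnC exprM.
    by rewrite (prim_expr_order pz) expr1n subrr.
  have : \sum_(i < p) (a i - a p.-1) * zeta ^+ k ^+ i = 0.
    under eq_bigr do rewrite mulrBl.
    by rewrite sumrB sk -mulr_sumr geo mulr0 subrr.
  rewrite -!(big_mkord xpredT (fun i => (a i - a p.-1) * zeta ^+ k ^+ i)).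
  rewrite -{1}(prednK (prime_gt0 pp)) big_nat_recr //=.
  by rewrite subrr mul0r addr0.
move=> ip; case: (ltnP i p.-1) => [/E0 /subr0_eq // | ip'].
by have -> : i = p.-1 by apply/eqP; rewrite eqn_leq ip' andbT -ltnS prednK ?prime_gt0.
Qed.

(** When p divides n, each n k + 1 is prime to n p, so the p distinct conjugates zeta^(n k + 1), k <
    p, are roots of a polynomial of degree less than p. *)
Lemma cyclo_coefs_eq0 p n zeta (a : nat -> algC) :
  (0 < n)%N -> prime p -> (p %| n)%N -> (n * p).-primitive_root zeta ->
  (forall i, (i < p)%N -> cyclo_fixed n (a i)) ->
  \sum_(i < p) a i * zeta ^+ i = 0 ->
  forall i, (i < p)%N -> a i = 0.
Proof.
move=> n0 pp p_n pz fa s0.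
apply: (@poly_coefs_eq0 _ _ _ [seq zeta ^+ (n * k).+1 | k <- iota 0 p]).
- rewrite map_inj_in_uniq ?iota_uniq // => j1 j2.
  rewrite !mem_iota !add0n => /andP[_ j1p] /andP[_ j2p] /eqP.
  rewrite (eq_prim_root_expr pz) -[_.+1]addn1 -[X in _ == X %[mod _]]addn1 eqn_modDr -!muln_modr.
  by rewrite eqn_pmul2l // !modn_small // => /eqP.
- by rewrite size_map size_iota.
move=> _ /mapP [k _ ->].
have Kn : (n * k).+1 = 1 %[mod n] by rewrite -addn1 mulnC modnMDl.
apply: (cyclo_conj (m := n * p) (n := n)) => //.
- have co_n : coprime (n * k).+1 n by rewrite -(coprime_modl _ n) Kn coprime_modl coprime1n.
  by rewrite coprimeMr co_n (coprime_dvdr p_n co_n).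
- exact: dvdn_mulr.
- exact: prim_expr_order pz.
Qed.

Lemma slice_diff_eq p n zeta x y :
  (0 < n)%N -> prime p -> coprime p n -> p.-primitive_root zeta ->
  unity_seq (n * p) x -> unity_seq (n * p) y ->
  \sum_(u <- x) u = \sum_(u <- y) u -> forall i j, (i < p)%N -> (j < p)%N ->
  \sum_(v <- slice n (zeta ^+ i) x) v - \sum_(v <- slice n (zeta ^+ i) y) v =
  \sum_(v <- slice n (zeta ^+ j) x) v - \sum_(v <- slice n (zeta ^+ j) y) v.
Proof.
move=> n0 pp co_pn pz ux uy xy.
have znp := exp_prim_root_coprime co_pn pz.
apply: (@cyclo_coefs_eq p n zeta (fun i =>
  \sum_(v <- slice n (zeta ^+ i) x) v - \sum_(v <- slice n (zeta ^+ i) y) v)) => //.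
  by move=> i _; apply: cyclo_fixedB; apply: cyclo_fixed_sum; apply: slice_unity.
under eq_bigr do rewrite mulrBl.
by rewrite sumrB -!sum_slice // xy subrr.
Qed.

(** * Comparing two lists with the same sum *)

Lemma unity_seq1 s : unity_seq 1 s -> s = nseq (size s) 1.
Proof. by move/all_pred1P. Qed.

Lemma sum_unity_seq1 s : unity_seq 1 s -> \sum_(u <- s) u = (size s)%:R.
Proof.
by move/unity_seq1 => {1}->; rewrite big_nseq iter_addr addr0.
Qed.

Lemma max_pdiv_squarefree_decomp n (p := max_pdiv n) (n' := (n %/ p)%N) :
  (1 < n)%N -> (forall q, prime q -> ~~ (q ^ 2 %| n)%N) ->
  [/\ prime p, n = (n' * p)%N, coprime p n', (0 < n')%N & (n' < n)%N].
Proof.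
move=> n1 sqf; have n0 := ltnW n1.
have pp : prime p := max_pdiv_prime n1.
have nE : n = (n' * p)%N by rewrite divnK ?max_pdiv_dvd.
have n'0 : (0 < n')%N by move: n0; rewrite nE muln_gt0 => /andP[].
split=> //; last by rewrite [ltnRHS]nE ltn_Pmulr // prime_gt1.
rewrite prime_coprime //; apply: contra (sqf p pp) => /dvdnP [c n'E].
by rewrite nE n'E -mulnA mulnn dvdn_mull.
Qed.

(** In the application [k] and [Y] are the lengths of x and y, [e] and [a] those of x_j and y_j, and
    [l] that of y_(i0). The last hypothesis says that x_j ++ y_(i0) is too long for the induction
    hypothesis, or that the latter makes y_j long. *)
Lemma large_slice_arith p1 p2 p k e l a Y :
  (p1 < p2)%N -> (p2 <= p)%N -> (e <= k)%N -> (k < p1)%N ->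
  (p.-1 * l + a <= Y + l * (k - e))%N ->
  (p1 <= l + e \/ l + e < p1 /\ (p1 - (l + e)) * p2.-1 <= a)%N ->
  ((p1 - k) * p2.-1 <= Y)%N.
Proof.
case: p2 => // q; rewrite ltnS /= => p1q qp ek kp1.
(* Naming the differences turns truncated subtractions into sums, as [nia] needs. *)
have [f fE] : exists f, k = (e + f)%N by exists (k - e)%N; rewrite subnKC.
have [b bE] : exists b, p1 = (k + b)%N by exists (p1 - k)%N; rewrite subnKC // ltnW.
have -> : (p1 - k = b)%N by rewrite bE addKn.
have -> : (k - e = f)%N by rewrite fE addKn.
have qp1 : (q * l <= p.-1 * l)%N by rewrite leq_mul2r; apply/orP; right; lia.
move=> hY [h|[h ha]].
  have [c lE] : exists c, l = (b + f + c)%N by exists (l - (b + f))%N; lia.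
  have [d qE] : exists d, q = (b + f + d)%N by exists (q - (b + f))%N; lia.
  by subst l q; nia.
have [c cE] : exists c, p1 = (l + e + c)%N by exists (p1 - (l + e))%N; lia.
have ha' : (c * q <= a)%N by move: ha; rewrite {1}cE addKn.
have [d qE] : exists d, q = (l + d)%N by exists (q - l)%N; lia.
have : (b + f = l + c)%N by lia.
by subst q; nia.
Qed.

Lemma slice_nil p n zeta x : p.-primitive_root (zeta ^+ n) -> (0 < n)%N ->
  unity_seq (n * p) x -> (size x < p)%N ->
  exists i : 'I_p, slice n (zeta ^+ i) x == [::].
Proof.
move=> pz n0 ux xp; apply/existsP; apply: contraLR xp; rewrite negb_exists => /forallP ne.
rewrite -leqNgt (size_slice pz) // -[leqLHS]card_ord -sum1_card.
by apply: leq_sum => i _; rewrite lt0n size_eq0.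
Qed.

(* By induction on n = n' p, with p the largest prime factor: choose i0 with
   x_(i0) empty and y_(i0) shortest; then x_j ++ y_(i0) and y_j have the same sum
   for all j, and the induction hypothesis compares them. *)
Lemma subset_or_large p1 p2 n x y : (p1 < p2)%N -> (0 < n)%N ->
  (forall q, prime q -> ~~ (q ^ 2 %| n)%N) ->
  (forall q, prime q -> (q %| n)%N -> q = p1 \/ (p2 <= q)%N) ->
  unity_seq n x -> unity_seq n y -> \sum_(u <- x) u = \sum_(u <- y) u ->
  (size x < p1)%N ->
  {subset x <= y} \/ ((p1 - size x) * p2.-1 <= size y)%N.
Proof.
move=> p12; elim/ltn_ind: n x y => n IHn x y n0 sqf npr ux uy xy xp1.
have [n1|n1] := leqP n 1.
  have nE : n = 1%N by apply/eqP; rewrite eqn_leq n1.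
  left; move: ux uy xy; rewrite {}nE => ux uy; rewrite !sum_unity_seq1 // => /eqP.
  rewrite eqr_nat => /eqP xy u.
  by rewrite (unity_seq1 ux) (unity_seq1 uy) xy.
have [pp nE co_pn' n'0 n'n] := max_pdiv_squarefree_decomp n1 sqf.
set p := max_pdiv n in pp nE co_pn' n'0 n'n; set n' := (n %/ p)%N in nE co_pn' n'0 n'n.
have [zeta pz] := C_prim_root_exists (prime_gt0 pp).
have znp := exp_prim_root_coprime co_pn' pz.
have p_n : (p %| n)%N := max_pdiv_dvd n.
have n'_n : (n' %| n)%N by rewrite nE dvdn_mulr.
have p_p1 : (p1 <= p)%N by case: (npr p pp p_n) => [->|/(leq_trans (ltnW p12))].
move: (ux) (uy); rewrite nE => uxnp uynp.
have diff := slice_diff_eq n'0 pp co_pn' pz uxnp uynp xy.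
pose X (i : 'I_p) := slice n' (zeta ^+ i) x; pose Y (i : 'I_p) := slice n' (zeta ^+ i) y.
have szx : size x = (\sum_(i < p) size (X i))%N by apply: size_slice.
have szy : size y = (\sum_(i < p) size (Y i))%N by apply: size_slice.
have [i1 Xi1] := slice_nil znp n'0 uxnp (leq_trans xp1 p_p1).
case: (arg_minnP (fun i => size (Y i)) (Xi1 : [pred i | X i == [::]] i1)) => i0 /= /eqP Xi0 min.
have sumY j : \sum_(v <- X j ++ Y i0) v = \sum_(v <- Y j) v.
  have := diff j i0 (ltn_ord j) (ltn_ord i0).
  rewrite -/(X j) -/(Y j) -/(X i0) -/(Y i0) Xi0 big_nil sub0r big_cat /= => /eqP.
  by rewrite subr_eq => /eqP ->; rewrite addrAC addNr add0r.
have uXY j : unity_seq n' (X j ++ Y i0) by rewrite /unity_seq all_cat; apply/andP; split; apply: slice_unity.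
(* If y is short, no slice can fall under the second alternative, so the inclusion can be proved
   coset by coset. *)
have [yl|yl] := leqP ((p1 - size x) * p2.-1) (size y); [by right | left].
apply: (slice_subset znp n'0 uxnp) => j; rewrite -/(X j) -/(Y j).
suff sub : {subset X j ++ Y i0 <= Y j}.
  by move=> v vX; apply: sub; rewrite mem_cat vX.
have [n'1|n'1] := leqP n' 1.
  have n'E : n' = 1%N by apply/eqP; rewrite eqn_leq n'1.
  have := sumY j; have := uXY j; have : unity_seq n' (Y j) := slice_unity _ _ _.
  rewrite n'E => u1 u2; rewrite !sum_unity_seq1 // => /eqP; rewrite eqr_nat => /eqP e v.
  by rewrite (unity_seq1 u1) (unity_seq1 u2) e.
(* A prime factor q of n' is smaller than p, so the two cannot both be p1. *)
have p2p : (p2 <= p)%N.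
  have [q pq q_n'] := pdivP n'1.
  have q_n : (q %| n)%N := dvdn_trans q_n' n'_n.
  have qp : (q <= p)%N by apply: max_pdiv_max; rewrite mem_primes pq n0.
  have q_neq_p : q != p.
    by apply: contraL co_pn' => /eqP <-; rewrite prime_coprime // negbK.
  case: (npr p pp p_n) => // pE; case: (npr q pq q_n) => [qE|/leq_trans-> //].
  by rewrite qE pE eqxx in q_neq_p.
(* For i <> j, the length of y_(i0) is at most that of y_i if x_i is empty, by minimality, and
   otherwise at most itself times the length of x_i. Sum over i. *)
have le_sum : (p.-1 * size (Y i0) + size (Y j)
               <= size y + size (Y i0) * (size x - size (X j)))%N.
  have -> : (size x - size (X j) = \sum_(i < p | i != j) size (X i))%N.
    by rewrite szx (bigD1 j) //= addKn.
  rewrite szy [in leqRHS](bigD1 j) //= addnC -addnA leq_add2l.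
  have -> : (p.-1 * size (Y i0) = \sum_(i < p | i != j) size (Y i0))%N.
    by rewrite sum_nat_const cardC1 card_ord.
  rewrite big_distrr -big_split /=; apply: leq_sum => i _.
  have [Xi|Xi] := eqVneq (X i) [::]; first by rewrite (leq_trans (min i _)) ?leq_addr //= Xi.
  by rewrite (leq_trans _ (leq_addl _ _)) // leq_pmulr // lt0n size_eq0.
have Xjx : (size (X j) <= size x)%N by rewrite szx (bigD1 j) //= leq_addr.
have large := large_slice_arith p12 p2p Xjx xp1 le_sum.
have [big|small] := leqP p1 (size (Y i0) + size (X j)).
  by move: yl; rewrite ltnNge large //; left.
case: (IHn n' n'n (X j ++ Y i0) (Y j)) => //.
- by move=> q pq; apply: contra (sqf q pq) => /dvdn_trans ->.
- by move=> q pq q_n'; apply: npr => //; apply: dvdn_trans n'_n.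
- exact: slice_unity.
- by rewrite size_cat addnC.
rewrite size_cat addnC => big.
by move: yl; rewrite ltnNge large //; right.
Qed.

(** * Non-negative integer combinations *)

Lemma in_nat_span0 s : in_nat_span s 0.
Proof. by exists (fun=> 0%N); rewrite big1. Qed.

Lemma in_nat_spanD s t u :
  in_nat_span s t -> in_nat_span s u -> in_nat_span s (t + u).
Proof.
move=> [c ->] [d ->]; exists (fun q => c q + d q)%N.
by rewrite -big_split; apply: eq_bigr => q _; rewrite mulnDl.
Qed.

Lemma in_nat_span_mul s q c : uniq s -> q \in s -> in_nat_span s (c * q).
Proof.
move=> us qs; exists (fun r => if r == q then c else 0%N).
rewrite (bigD1_seq q) //= eqxx big1 ?addn0 // => r /negPf ->.
by rewrite mul0n.
Qed.

Lemma in_nat_span_sum (I : finType) s (f : I -> nat) :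
  (forall i, in_nat_span s (f i)) -> in_nat_span s (\sum_i f i).
Proof.
move=> sf; apply: big_ind => //; first exact: in_nat_span0.
exact: in_nat_spanD.
Qed.

Lemma in_nat_span_subset s s' t : uniq s' -> {subset s <= s'} ->
  in_nat_span s t -> in_nat_span s' t.
Proof.
move=> us' ss' [c ->]; rewrite big_seq; apply: big_ind => [|x y|q /ss' qs'].
- exact: in_nat_span0.
- exact: in_nat_spanD.
- exact: in_nat_span_mul.
Qed.

(** This is the Frobenius coin problem for two generators. Choose d < a with d b = t mod a; if d b >
    t, then d b - t >= a, so t <= (a - 1) b - a < (a - 1)(b - 1). *)
Lemma coprime_coin a b t : coprime a b -> (a.-1 * b.-1 <= t)%N ->
  exists c d, t = (c * a + d * b)%N.
Proof.
have [->|a0] := posnP a.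
  by rewrite /coprime gcd0n => /eqP -> _; exists 0%N, t; rewrite muln1.
have [->|b0] := posnP b.
  by rewrite /coprime gcdn0 => /eqP -> _; exists t, 0%N; rewrite muln1 addn0.
move=> co_ab t_ge; pose d := (chinese a b t 0 %/ b %% a)%N.
have b_ch : (b %| chinese a b t 0)%N by rewrite /dvdn chinese_modr // mod0n.
have d_lt : (d < a)%N by rewrite ltn_mod.
have db : (d * b = t %[mod a])%N by rewrite modnMml divnK // chinese_modl.
have [le|lt] := leqP (d * b) t.
  have /dvdnP [c cE] : (a %| t - d * b)%N by rewrite -eqn_mod_dvd // db.
  by exists c, d; rewrite -cE subnK.
have /dvdnP [c cE] : (a %| d * b - t)%N by rewrite -eqn_mod_dvd ?(ltnW lt) // db.
have c0 : (0 < c)%N by case: c cE => // /eqP; rewrite mul0n subn_eq0 leqNgt lt.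
suff : (d * b < d * b)%N by rewrite ltnn.
have : (a <= d * b - t)%N by rewrite cE leq_pmull.
move: d_lt t_ge b0 lt; case: (a) a0 => // a' _; case: (b) => // b' /=; nia.
Qed.

(** * Lengths of vanishing sums of roots of unity *)

Lemma primes_dvd_sub m n : (0 < n)%N -> (m %| n)%N -> {subset primes m <= primes n}.
Proof.
move=> n0 mn q; rewrite !mem_primes n0 => /and3P[-> _ /dvdn_trans -> //].
Qed.

Theorem lam_leung m x : (0 < m)%N -> unity_seq m x -> \sum_(u <- x) u = 0 ->
  in_nat_span (primes m) (size x).
Proof.
elim/ltn_ind: m x => m IHm x m0.
have IHd n y : (n %| m)%N -> (n < m)%N -> unity_seq n y ->
    \sum_(u <- y) u = 0 -> in_nat_span (primes m) (size y).
  move=> n_m nm uy y0; have n0 := dvdn_gt0 m0 n_m.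
  exact: in_nat_span_subset (primes_uniq m) (primes_dvd_sub m0 n_m) (IHm n nm y n0 uy y0).
(* The inner induction on the length serves the removal of a coset, which leaves m unchanged. *)
have [N] := ubnP (size x); elim: N x => // N IHN x; rewrite ltnS => xN ux x0.
have [m1|m1] := leqP m 1.
  have mE : m = 1%N by apply/eqP; rewrite eqn_leq m1.
  move: ux x0; rewrite {1}mE => ux; rewrite sum_unity_seq1 // => /eqP.
  by rewrite pnatr_eq0 => /eqP ->; apply: in_nat_span0.
case: (altP (@allP _ (fun q => ~~ (q ^ 2 %| m)%N) (primes m))) => [sqf | /allPn [p pm]]; last first.
  rewrite negbK => /dvdnP [c mE].
  have pp : prime p by move: pm; rewrite mem_primes => /andP[].
  pose n := (c * p)%N; have mE' : m = (n * p)%N by rewrite mE mulnA.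
  have n0 : (0 < n)%N by move: m0; rewrite mE' muln_gt0 => /andP[].
  have p_n : (p %| n)%N by rewrite dvdn_mull.
  have [zeta zm] := C_prim_root_exists m0.
  rewrite mE' in zm ux.
  have znp : p.-primitive_root (zeta ^+ n).
    by have := exp_prim_root zm n; rewrite (gcdn_idPl (dvdn_mulr _ (dvdnn _))) mulKn.
  have xs0 : forall i, (i < p)%N -> \sum_(v <- slice n (zeta ^+ i) x) v = 0.
    apply: (cyclo_coefs_eq0 n0 pp p_n zm) => [i _|].
      by apply: cyclo_fixed_sum; apply: slice_unity.
    by rewrite -sum_slice.
  rewrite (size_slice znp) //; apply: in_nat_span_sum => i.
  apply: (IHd n) => //; first by rewrite mE' dvdn_mulr.
  - by rewrite [ltnRHS]mE' ltn_Pmulr // prime_gt1.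
  - exact: slice_unity.
  - exact: xs0.
have {}sqf q : prime q -> ~~ (q ^ 2 %| m)%N.
  move=> pq; apply/negP => q2; have /sqf/negP[] // : q \in primes m.
  by rewrite mem_primes pq m0 (dvdn_trans _ q2) // dvdn_exp.
have [pp mE co_pn n0 nm] := max_pdiv_squarefree_decomp m1 sqf.
set p := max_pdiv m in pp mE co_pn n0 nm; set n := (m %/ p)%N in mE co_pn n0 nm.
have p_m : (p %| m)%N := max_pdiv_dvd m.
have p_gt1 := prime_gt1 pp.
have n_m : (n %| m)%N by rewrite mE dvdn_mulr.
have primes_m q : prime q -> (q %| m)%N -> q \in primes m.
  by rewrite mem_primes m0 => -> ->.
have [zeta pz] := C_prim_root_exists (prime_gt0 pp).
have znp := exp_prim_root_coprime co_pn pz.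
have uxnp : unity_seq (n * p) x by rewrite -mE.
pose X (i : 'I_p) := slice n (zeta ^+ i) x.
have szx : size x = (\sum_(i < p) size (X i))%N by apply: size_slice.
have uX i : unity_seq n (X i) by apply: slice_unity.
have sumX i j : \sum_(v <- X i) v = \sum_(v <- X j) v.
  (* Compare x with the empty list, which also has sum 0. *)
  have := slice_diff_eq n0 pp co_pn pz uxnp (isT : unity_seq (n * p) [::]).
  rewrite big_nil => /(_ x0) /(_ i j (ltn_ord i) (ltn_ord j)).
  by rewrite !subr0.
pose o : 'I_p := Ordinal (prime_gt0 pp).
case: (arg_minnP (fun i => size (X i)) (isT : predT o)) => i0 _ min.
have [Xi0|Xi0] := eqVneq (X i0) [::].
  rewrite szx; apply: in_nat_span_sum => i; apply: (IHd n) => //.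
  by rewrite (sumX i i0) Xi0 big_nil.
have Xi0_gt0 : (0 < size (X i0))%N by rewrite lt0n size_eq0.
(* One term v of x_(i0) is enough: all v zeta^i occur in x, and these p terms sum to 0. *)
have remove_coset : (forall i, {subset X i0 <= X i}) -> in_nat_span (primes m) (size x).
  move=> sub; pose v := head 0 (X i0).
  have vX i : v \in X i by apply: sub; rewrite /v; case: (X i0) Xi0 => //= *; apply: mem_head.
  pose L := [seq v * zeta ^+ i | i : 'I_p].
  have v0 : v != 0.
    apply/eqP => v0; have := allP (uX i0) v (vX i0).
    by rewrite v0 expr0n gtn_eqF // eq_sym oner_eq0.
  have L_uniq : uniq L.
    rewrite map_inj_uniq ?enum_uniq // => i j /(mulfI v0) eq_ij.
    by apply: val_inj; apply: (prim_root_expr_inj pz) eq_ij; rewrite inE.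
  have L_x : {subset L <= x}.
    move=> _ /mapP [i _ ->]; have := vX i; rewrite mem_slice; first by case/andP.
    exact: (slice_base_neq0 znp).
  have L0 : \sum_(u <- L) u = 0.
    rewrite big_map big_enum /= -mulr_sumr; apply/eqP; rewrite mulf_eq0; apply/orP; right.
    have z1 : zeta - 1 != 0.
      rewrite subr_eq0 -[X in _ == X](expr0 zeta) -[X in X == _]expr1.
      by rewrite (eq_prim_root_expr pz) mod0n modn_small.
    rewrite -(inj_eq (mulfI z1)) mulr0 -subrX1.
    by rewrite (prim_expr_order pz) subrr.
  (* As [L] has no repetition, its inclusion in x respects multiplicities, so x is a permutation of
     [L] followed by a remainder. *)
  have [|s s_x L_s] := (count_subseqP L x).1.
    move=> u; rewrite count_uniq_mem //; case: (boolP (u \in L)) => // /L_x.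
    by rewrite -has_pred1 has_count.
  have [x' xE] := perm_to_subseq s_x.
  have {L_s s_x}xE : perm_eq x (L ++ x').
    by rewrite (perm_trans xE) // perm_cat2r perm_sym.
  have szxE : size x = (p + size x')%N.
    by rewrite (perm_size xE) size_cat size_map -cardE card_ord.
  rewrite szxE; apply: in_nat_spanD.
    by rewrite -[p]mul1n; apply: in_nat_span_mul; rewrite ?primes_uniq ?primes_m.
  apply: IHN.
  - by rewrite (leq_trans _ xN) // szxE -[ltnLHS]add0n ltn_add2r prime_gt0.
  - by have := ux; rewrite /unity_seq (perm_all _ xE) all_cat => /andP[].
  - by have := x0; rewrite (perm_big _ xE) big_cat /= L0 add0r.
have [n1|n1] := leqP n 1.
  have nE : n = 1%N by apply/eqP; rewrite eqn_leq n1.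
  apply: remove_coset => i; have := sumX i0 i; have := uX i; have := uX i0.
  rewrite nE => u1 u2; rewrite !sum_unity_seq1 // => /eqP; rewrite eqr_nat => /eqP e v.
  by rewrite (unity_seq1 u1) (unity_seq1 u2) e.
(* Since m is squarefree, p1 does not divide m / p1, so [p2] is the second smallest prime factor of
   m. *)
pose p1 := pdiv m; pose p2 := pdiv (m %/ p1).
have p1p : prime p1 := pdiv_prime m1.
have p1_m : (p1 %| m)%N := pdiv_dvd m.
have mp1 : m = (m %/ p1 * p1)%N by rewrite divnK.
have p1_lt_p : (p1 < p)%N.
  have [q pq q_n] := pdivP n1; have q_m := dvdn_trans q_n n_m.
  rewrite (leq_ltn_trans (pdiv_min_dvd (prime_gt1 pq) q_m)) // ltn_neqAle.
  rewrite max_pdiv_max ?primes_m // andbT.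
  by apply: contraL co_pn => /eqP <-; rewrite prime_coprime // negbK.
have prime_dvd_quo q : prime q -> (q %| m)%N -> q != p1 -> (q %| m %/ p1)%N.
  move=> pq; rewrite {1}mp1 Euclid_dvdM // => /orP[//|].
  by rewrite dvdn_prime2 // => ->.
have quo_gt1 : (1 < m %/ p1)%N.
  rewrite (leq_trans p_gt1) // dvdn_leq ?prime_dvd_quo // ?gtn_eqF //.
  by rewrite divn_gt0 ?prime_gt0 // dvdn_leq.
have p2p : prime p2 := pdiv_prime quo_gt1.
have p2_quo : (p2 %| m %/ p1)%N := pdiv_dvd _.
have p2_m : (p2 %| m)%N by rewrite mp1 dvdn_mulr.
have p12 : (p1 < p2)%N.
  rewrite ltn_neqAle pdiv_min_dvd ?prime_gt1 // andbT.
  apply: contra (sqf p1 p1p) => /eqP p12; rewrite mp1 -mulnn dvdn_mul //.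
  by rewrite {1}p12.
have npr q : prime q -> (q %| m)%N -> q = p1 \/ (p2 <= q)%N.
  move=> pq qm; have [|qp1] := eqVneq q p1; first by left.
  by right; rewrite pdiv_min_dvd ?prime_gt1 // prime_dvd_quo.
have p2_le_p : (p2 <= p)%N by case: (npr p pp p_m) => // pE; rewrite pE ltnn in p1_lt_p.
have [big|small] := leqP (p1.-1 * p2.-1) (size x).
  have co12 : coprime p1 p2 by rewrite prime_coprime // dvdn_prime2 // neq_ltn p12.
  have [c [d ->]] := coprime_coin co12 big.
  by apply: in_nat_spanD; apply: in_nat_span_mul; rewrite ?primes_uniq ?primes_m.
apply: remove_coset => j.
have le_sum : (p.-1 * size (X i0) + size (X j) <= size x)%N.
  rewrite szx [in leqRHS](bigD1 j) //= addnC leq_add2l.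
  have -> : (p.-1 * size (X i0) = \sum_(i < p | i != j) size (X i0))%N.
    by rewrite sum_nat_const cardC1 card_ord.
  by apply: leq_sum => i _; apply: min.
have szj : (size (X i0) <= size (X j))%N by apply: min.
case: (@subset_or_large p1 p2 n (X i0) (X j)) => //.
- by move=> q pq; apply: contra (sqf q pq) => /dvdn_trans ->.
- by move=> q pq q_n; apply: npr => //; apply: dvdn_trans n_m.
(* If x_(i0) had p1 or more terms, x would have at least (p - 1) p1 terms, contrary to [small]. *)
- by move: p12 p2_le_p small le_sum szj; clear; move: (size _) (size _) (size _) (p) p1 p2; nia.
(* With a the length of x_(i0), x would have at least (p2 - 1) a + (p1 - a)(p2 - 1) = p1 (p2 - 1)
   terms, contrary to [small]. *)
move=> large; exfalso.
move: p12 p2_le_p small le_sum large Xi0_gt0; clear.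
move: (size _) (size _) (size _) (p) p1 p2 => a b c p' p1 p2; nia.
Qed.


(** * Transfer of integer relations to [algC] *)

Lemma intr_eq0_pchar0 (F : fieldType) (k : int) :
  [pchar F] =i pred0 -> (k%:~R == 0 :> F) = (k == 0).
Proof.
move/pcharf0P => F0; case: k => k; first by rewrite -pmulrn F0.
by rewrite NegzE rmorphN !oppr_eq0 /= -pmulrn F0.
Qed.

(** X^m - 1 is the product of the Phi_d with d | m, so w is a root of some Phi_d; then w^d = 1,
    which forces d = m. *)
Lemma root_Cyclotomic_prim (F : fieldType) m (w : F) :
  m.-primitive_root w -> root (map_poly intr 'Phi_m) w.
Proof.
move=> wm; have m0 := prim_order_gt0 wm.
have dvd_root d : (0 < d)%N -> root (map_poly intr 'Phi_d) w -> w ^+ d = 1.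
  move=> d0 /eqP rd; have := congr1 (fun P => (map_poly intr P).[w]) (prod_Cyclotomic d0).
  have d_d : d \in divisors d by rewrite -dvdn_divisors.
  rewrite (bigD1_seq d) ?divisors_uniq //= rmorphM hornerM rd mul0r.
  rewrite rmorphB rmorphXn rmorph1 /= map_polyX !hornerE.
  by move/esym/eqP; rewrite subr_eq0 => /eqP.
have := congr1 (fun P => (map_poly intr P).[w]) (prod_Cyclotomic m0).
rewrite rmorphB rmorphXn rmorph1 /= map_polyX rmorph_prod horner_prod !hornerE.
rewrite (prim_expr_order wm) subrr => /eqP.
rewrite prodf_seq_eq0 => /hasP [d]; rewrite -dvdn_divisors //= => d_m rd.
have d0 := dvdn_gt0 m0 d_m.
suff -> : m = d by [].
apply/eqP; rewrite eqn_dvd d_m andbT (prim_order_dvd wm).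
by rewrite dvd_root.
Qed.

(** Some automorphism of [algC] sends y to z, and it fixes integer coefficients. *)
Lemma root_int_poly_conj (P : {poly int}) m (y z : algC) :
  m.-primitive_root y -> m.-primitive_root z ->
  root (map_poly intr P) y -> root (map_poly intr P) z.
Proof.
move=> ym zm Py; have [k zE] := prim_rootP ym (prim_expr_order zm).
have co_k : coprime k m by rewrite -(prim_root_exp_coprime _ ym) -zE.
have [nu nuE] := Qn_aut_exists co_k.
have <- : nu y = z by rewrite nuE ?(prim_expr_order ym).
have <- : map_poly nu (map_poly intr P) = map_poly intr P.
  by rewrite -map_poly_comp; apply: eq_map_poly => a /=; rewrite rmorph_int.
by rewrite fmorph_root.
Qed.

(* If [P] did not vanish at [z], it would have no root in common with [Phi_m]
   by conjugacy, so the nonzero integer resultant of [P] and [Phi_m] would be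
   a combination of polynomials vanishing at [w]. *)
Lemma root_int_poly_transfer (F : fieldType) (P : {poly int}) m (w : F) (z : algC) :
  [pchar F] =i pred0 -> m.-primitive_root w -> m.-primitive_root z ->
  root (map_poly intr P) w -> root (map_poly intr P) z.
Proof.
move=> F0 wm zm Pw.
have [/size1_polyC PE|P1] := leqP (size P) 1.
  move: Pw; rewrite PE !map_polyC /= !rootC intr_eq0_pchar0 // => /eqP ->.
  by rewrite rmorph0.
have Phi1 : (1 < size 'Phi_m)%N.
  by rewrite size_Cyclotomic ltnS totient_gt0 (prim_order_gt0 wm).
have [[u v] _ /= res] := resultant_in_ideal P1 Phi1.
have res0 : resultant P 'Phi_m = 0.
  have := congr1 (fun Q => (map_poly intr Q).[w]) res.
  rewrite rmorphD !rmorphM !hornerE (eqP Pw) (eqP (root_Cyclotomic_prim wm)).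
  rewrite !mulr0 addr0 map_polyC hornerC /= => /eqP.
  by rewrite intr_eq0_pchar0 // => /eqP.
move/eqP: res0; rewrite resultant_eq0 => gcd_gt1.
pose d := gcdp P 'Phi_m; pose toC := map_poly (intr : int -> algC).
have [y dy] : exists y, root (toC d) y.
  apply/closed_rootP; rewrite size_map_inj_poly ?gtn_eqF //.
  exact: intr_inj.
(* Divisibility over [int] concerns only a nonzero multiple c Q; the constant c can be cancelled in
   [algC]. *)
have root_multiple Q : d %| Q -> root (toC Q) y.
  move=> /Pdiv.WeakIdomain.dvdpP [[c q] /= c0 /(congr1 (fun R => (toC R).[y]))].
  rewrite /toC map_polyZ rmorphM !hornerE (eqP dy) mulr0 => /eqP.
  by rewrite mulf_eq0 intr_eq0 (negPf c0).
have Py := root_multiple P (dvdp_gcdl _ _).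
have := root_multiple 'Phi_m (dvdp_gcdr _ _).
rewrite /toC (Cintr_Cyclotomic zm) root_cyclotomic // => ym.
exact: root_int_poly_conj ym zm Py.
Qed.

(** * Character values as sums of roots of unity *)

(** A is annihilated by X^m - 1, which has m distinct roots w^i in F, so A is diagonalizable with
    m-th roots of unity on the diagonal. *)
Lemma trace_unity_mx (F : fieldType) m n (w : F) (A : 'M[F]_n) :
  m.-primitive_root w -> A ^+ m = 1 ->
  exists e : 'I_n -> 'I_m, \tr A = \sum_i w ^+ e i.
Proof.
case: n A => [|n] A wm Am.
  by exists (fun i => Ordinal (prim_order_gt0 wm)); rewrite big_ord0 /mxtrace big_ord0.
have [_ /(_ _)/= []] := diagonalizableP A.
  exists [seq w ^+ i | i <- index_iota 0 m].
    rewrite map_inj_in_uniq ?iota_uniq // => i j.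
    by rewrite !mem_index_iota; apply: prim_root_expr_inj.
  rewrite big_map factor_Xn_sub_1 //; apply: mxminpoly_min.
  by rewrite rmorphB rmorphXn rmorph1 /= horner_mx_X Am subrr.
move=> P uP /(similar_diagLR uP) [D AE].
have AD : P *m A = diag_mx D *m P by rewrite AE conjVmx // !mulmxA mulmxV // mul1mx.
have DX k : P *m A ^+ k = diag_mx D ^+ k *m P.
  elim: k => [|k IHk]; first by rewrite mulmx1 mul1mx.
  by rewrite exprSr mulmxA IHk -mulmxA AD mulmxA exprSr.
have Dm : diag_mx D ^+ m = 1.
  have := DX m; rewrite Am mulmx1 -[X in X = _ -> _]mul1mx => /(congr1 (mulmx^~ (invmx P))).
  by rewrite !mulmxK.
have Di i : D 0 i ^+ m = 1.
  have Dk k : diag_mx D ^+ k = diag_mx (\row_j D 0 j ^+ k).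
    elim: k => [|k IHk].
      by apply/matrixP => a b; rewrite !mxE expr0.
    rewrite exprSr IHk -[_ * _]/(_ *m _) mulmx_diag; congr diag_mx.
    by apply/rowP => j; rewrite !mxE exprSr.
  by have /matrixP/(_ i i) := Dm; rewrite Dk !mxE eqxx.
exists (fun i => sval (prim_rootP wm (Di i))).
rewrite AE conjVmx // mxtrace_mulC mulmxA mulmxV // mul1mx mxtrace_diag.
by apply: eq_bigr => i _; case: prim_rootP.
Qed.

(** Over an extension of F with a primitive m-th root w, the value of the character says that w is a
    root of an integer polynomial sum_i X^(e i) - z, and this is transferred to zeta in [algC]. *)
Lemma char_unity_seq (F : fieldType) (gT : finGroupType) (G : {group gT})
    (n : nat) (rG : mx_representation F G n) (g : gT) (z : int) :
  [pchar F] =i pred0 -> g \in G -> repr_char rG g = z%:~R ->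
  exists s, [/\ unity_seq #[g]%g s, size s = n & \sum_(u <- s) u = z%:~R].
Proof.
move=> F0 gG chi_g; set m := #[g]%g.
have [zeta zm] := C_prim_root_exists (order_gt0 g : (0 < m)%N).
(* The goal is made boolean because the extension field and its root w exist only [classically]. *)
suff : [exists e : {ffun 'I_n -> 'I_m}, \sum_i zeta ^+ e i == z%:~R].
  case/existsP => e /eqP e_z; exists [seq zeta ^+ e i | i : 'I_n].
  split; last by rewrite big_map big_enum.
    apply/allP => _ /mapP [i _ ->].
    by rewrite -exprM mulnC exprM (prim_expr_order zm) expr1n.
  by rewrite size_map -cardE card_ord.
have Am : rG g ^+ m = 1.
  case: (n) (rG) => [|n'] rG'; first by rewrite [LHS]thinmx0 [RHS]thinmx0.
  by rewrite -repr_mxX // expg_order repr_mx1.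
apply: (@group_splitting_field_exists _ <[g]>%G F) => -[Fs iota splitFs].
have Fs0 : [pchar Fs] =i pred0 by move=> q; rewrite (fmorph_pchar iota) F0.
have Fs_pchar : ([pchar Fs]^'.-group <[g]>)%g.
  by apply/pgroupP => q _ _; rewrite inE /= Fs0.
apply: (splitting_cyclic_primitive_root_pchar (cycle_cyclic g) Fs_pchar splitFs).
move=> [w wm]; rewrite -[#|_|]/m in wm.
have Bm : map_mx iota (rG g) ^+ m = 1 by rewrite -rmorphXn Am rmorph1.
have [e trE] := trace_unity_mx wm Bm.
pose P : {poly int} := \sum_i 'X^(e i) - z%:P.
have PE (R : nzRingType) (v : R) :
    (map_poly intr P).[v] = \sum_i v ^+ e i - z%:~R.
  rewrite rmorphB rmorph_sum /= map_polyC !hornerE horner_sum; congr (_ - _).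
  by apply: eq_bigr => i _; rewrite map_polyXn hornerXn.
have Pw : root (map_poly intr P) w.
  by rewrite rootE PE -trE trace_map_mx -/(repr_char rG g) chi_g rmorph_int subrr.
have := root_int_poly_transfer Fs0 wm zm Pw; rewrite rootE PE subr_eq0 => e_z.
by apply/existsP; exists (finfun e); under eq_bigr do rewrite ffunE.
Qed.

(** * Parity and the character theorem *)

(** If every generator with a positive coefficient were even, t would be even. *)
Lemma odd_nat_span s t : (forall p, p \in s -> prime p) -> in_nat_span s t -> odd t ->
  exists p, [/\ p \in s, prime p, odd p & (p <= t)%N].
Proof.
move=> s_pr [c ->] odd_t.
have /hasP [p ps /andP[odd_p cp]] : has (fun p => odd p && (0 < c p)%N) s.
  apply: contraLR odd_t => /hasPn ev; rewrite -dvdn2 big_seq.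
  apply: dvdn_sum => p /ev; rewrite negb_and -dvdn2 lt0n negbK.
  by case/orP => [?|/eqP ->]; rewrite ?mul0n ?dvdn0 // dvdn_mull.
exists p; split => //; first exact: s_pr.
by rewrite (big_rem p) //= (leq_trans (leq_pmull _ cp)) ?leq_addr.
Qed.

Lemma smallest_odd_prime_divisor_exists m p : prime p -> odd p -> (p %| m)%N ->
  exists l, smallest_odd_prime_divisor m l /\ (l <= p)%N.
Proof.
move=> pp odd_p p_m.
have ex : exists q, [&& prime q, odd q & (q %| m)%N] by exists p; apply/and3P.
case: (ex_minnP ex) => l /and3P[pl odd_l l_m] min.
exists l; split; last by apply: min; apply/and3P.
by split=> // q pq odd_q q_m; apply: min; apply/and3P.
Qed.

Theorem theorem7p1 (F : fieldType) (charF0 : [pchar F] =i pred0)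
    (gT : finGroupType) (G : {group gT}) (n : nat)
    (rG : mx_representation F G n) (g : gT) (gG : g \in G)
    (z : int) (chi_g : repr_char rG g = z%:~R)
    (t : nat) (t_def : t%:R = repr_char rG 1%g + (`|z|%N)%:R) :
  (z <= 0 -> in_nat_span (primes #[g]%g) t) /\
  (0 < z -> odd t ->
     exists l : nat, smallest_odd_prime_divisor #[g]%g l /\ (l <= t)%N).
Proof.
have m0 := order_gt0 g; set m := #[g]%g in m0 *.
(* The equation defining t holds in F; characteristic 0 makes it an equation between natural
   numbers. *)
have tE : t = (n + `|z|)%N.
  have /eqP : (t%:~R - (n + `|z|)%N%:~R : F) = 0.
    by rewrite -!pmulrn t_def /repr_char repr_mx1 mxtrace1 natrD subrr.
  by rewrite -rmorphB intr_eq0_pchar0 // subr_eq0 eqz_nat => /eqP.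
have [s [us ss s_z]] := char_unity_seq charF0 gG chi_g.
rewrite -/m in us.
split=> [z_le0|z_gt0 odd_t].
  have -> : t = size (s ++ nseq `|z| 1) by rewrite size_cat size_nseq ss.
  apply: lam_leung => //; first by rewrite /unity_seq all_cat -/(unity_seq m s) us all_nseq expr1n eqxx orbT.
  rewrite big_cat /= s_z big_nseq iter_addr addr0 pmulrn -rmorphD /=.
  by rewrite -[Posz _]/(`|z|%N%:Z) abszE ler0_norm // subrr.
(* Passing to (2 m)-th roots of unity admits -1 and adds at most the prime 2, which the oddness of p
   excludes. *)
have [p [p_pr pp odd_p p_t]] : exists p, [/\ p \in primes (2 * m), prime p, odd p & (p <= t)%N].
  apply: odd_nat_span => //; first by move=> q; rewrite mem_primes => /andP[].
  have -> : t = size (s ++ nseq `|z| (-1)) by rewrite size_cat size_nseq ss.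
  apply: lam_leung; first by rewrite muln_gt0.
    rewrite /unity_seq all_cat all_nseq exprM sqrrN !expr1n eqxx orbT andbT.
    by apply/allP => u /(allP us) /eqP um; rewrite mulnC exprM um expr1n.
  rewrite big_cat /= s_z big_nseq iter_addr addr0 mulNrn pmulrn -rmorphB /=.
  by rewrite abszE gtr0_norm // subrr.
have p_m : (p %| m)%N.
  move: p_pr; rewrite mem_primes => /and3P[_ _]; rewrite Euclid_dvdM //.
  by case/orP => // p2; move: odd_p; rewrite (eqP (_ : p == 2%N)) // -(dvdn_prime2 pp).
have [l [l_min l_p]] := smallest_odd_prime_divisor_exists pp odd_p p_m.
by exists l; split=> //; apply: leq_trans p_t.
Qed.
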